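(* For all $\lambda\in\mathbf{k}$ and $v\in\mathcal{V}^{\mathrm{B}}$, one has in $\mathcal{V}^{\mathrm{B}}\otimes\mathcal{V}^{\mathrm{B}}$: \[\Delta^{\mathcal{W},\mathrm{B}}\big(\lambda+v(X_1-1)\big)=\lambda\,(1\otimes1)+\mathsf{r}\underline{\mathrm{row}}\cdot\mathsf{r}\underline{\rho}(v)\cdot\mathsf{r}\underline{\mathrm{col}},\] i.e. $\Delta^{\mathcal{W},\mathrm{B}}$ followed by the inclusion $\mathcal{W}^{\mathrm{B}}\otimes\mathcal{W}^{\mathrm{B}}\hookrightarrow\mathcal{V}^{\mathrm{B}}\otimes\mathcal{V}^{\mathrm{B}}$ equals $\Delta_{\mathcal{O}^{\mathrm{B}}_{\mathsf{mat}}}$ composed with the isomorphism $\mathcal{W}^{\mathrm{B}}\cong\mathbf{k}\oplus(\mathcal{V}^{\mathrm{B}},\cdot_{X_1-1})$.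
   Context: $\mathbf{k}$ is a commutative $\mathbb{Q}$-algebra; $F_2$ free on $X_0,X_1$, $\mathcal{V}^{\mathrm{B}}=\mathbf{k}F_2$; in $\mathcal{V}^{\mathrm{B}}\otimes\mathcal{V}^{\mathrm{B}}$, $X_i=X_i\otimes1$, $Y_i=1\otimes X_i$. $\mathrm{op}_G$ is the antiautomorphism $g\mapsto g^{-1}$ of $\mathbf{k}G$. $\underline{\rho}:\mathcal{V}^{\mathrm{B}}\to M_3(\mathcal{V}^{\mathrm{B}}\otimes\mathcal{V}^{\mathrm{B}})$ is the algebra morphism with $\underline{\rho}(X_0)=\begin{pmatrix}X_0&0&0\\0&(1-X_1)X_0+Y_1^{-1}Y_0Y_1&(1-X_1)X_0X_1\\0&X_0-Y_1^{-1}Y_0Y_1X_1^{-1}&X_0X_1\end{pmatrix}$, $\underline{\rho}(X_1)=\begin{pmatrix}(X_1-1)Y_1+1&Y_1(1-Y_1)&0\\1-X_1&Y_1&0\\0&0&1\end{pmatrix}$; with $D=\mathrm{diag}(Y_1,X_1,(X_0X_1)^{-1}Y_1^{-1}Y_0Y_1)$, $\mathsf{r}\underline{\rho}(v):=D^{-1}M_3(\mathrm{op}_{F_2^2})({}^t\underline{\rho}(\mathrm{op}_{F_2}(v)))D$ (entrywise $\mathrm{op}$, transpose). $\mathsf{r}\underline{\mathrm{row}}=(Y_1,\,-X_1Y_1,\,0)\in M_{1,3}$, $\mathsf{r}\underline{\mathrm{col}}=Y_1^{-1}\,{}^t(X_1-1,\,1-Y_1,\,0)\in M_{3,1}$. For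 an algebra $B$ and $e\in B$, $\mathbf{k}\oplus(B,\cdot_e)$ is the algebra with product $(\lambda,b)(\lambda',b')=(\lambda\lambda',\lambda b'+\lambda'b+beb')$; $\Delta_{\mathcal{O}^{\mathrm{B}}_{\mathsf{mat}}}:\mathbf{k}\oplus(\mathcal{V}^{\mathrm{B}},\cdot_{X_1-1})\to\mathcal{V}^{\mathrm{B}}\otimes\mathcal{V}^{\mathrm{B}}$ is $(\lambda,v)\mapsto\lambda+\mathsf{r}\underline{\mathrm{row}}\,\mathsf{r}\underline{\rho}(v)\,\mathsf{r}\underline{\mathrm{col}}$. $\mathcal{W}^{\mathrm{B}}=\mathbf{k}\oplus\mathcal{V}^{\mathrm{B}}(X_1-1)$ is a subalgebra, isomorphic to $\mathbf{k}\oplus(\mathcal{V}^{\mathrm{B}},\cdot_{X_1-1})$ via $(\lambda,v)\mapsto\lambda+v(X_1-1)$; it is generated by $X_1^{-1}$ and $X_0^n(X_1-1)$, $n\in\mathbb{Z}$. $\Delta^{\mathcal{W},\mathrm{B}}:\mathcal{W}^{\mathrm{B}}\to\mathcal{W}^{\mathrm{B}}\otimes\mathcal{W}^{\mathrm{B}}$ is the (known to exist) algebra morphism with $\Delta^{\mathcal{W},\mathrm{B}}(X_1^{-1})=X_1^{-1}\otimes X_1^{-1}$ and $\Delta^{\mathcal{W},\mathrm{B}}(X_0^n(X_1-1))=X_0^n(X_1-1)\otimes1+1\otimes X_0^n(X_1-1)-\sum_{k=1}^{n-1}X_0^k(X_1-1)\otimes X_0^{n-k}(X_1-1)$ for $n\in\mathbb{Z}$,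 with the convention $\sum_{k=p}^qf(k)=f(p)+\dots+f(q)$ if $q>p-1$, $0$ if $q=p-1$, $-f(p-1)-\dots-f(q+1)$ if $q<p-1$. *)

(* Defs.v *)
From HB Require Import structures.
From mathcomp Require Import all_boot all_algebra.
From mathcomp Require Import finmap.
From mathcomp.multinomials Require Import monalg.

Set Implicit Arguments.
Unset Strict Implicit.
Unset Printing Implicit Defensive.

Import GRing.Theory.
Local Open Scope fset.
Local Open Scope ring_scope.

(*    A letter (i, e) stands for X_i^{+1} if e = false and X_i^{-1} if e = true *)
(*    (i = false for X_0, i = true for X_1).                                  *)

Definition letter := (bool * bool)%type.
Definition linv (l : letter) : letter := (l.1, ~~ l.2).

Lemma linvK : involutive linv.
Proof. by case=> a b; rewrite /linv /= negbK. Qed.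

Definition lcons (l : letter) (w : seq letter) : seq letter :=
  if w is l' :: w' then (if l' == linv l then w' else l :: w) else [:: l].

Fixpoint reduced (w : seq letter) : bool :=
  if w is a :: w' then
    (if w' is b :: _ then b != linv a else true) && reduced w'
  else true.

Lemma reduced_cons a w : reduced (a :: w) -> reduced w.
Proof. by case/andP. Qed.

Lemma lcons_reduced l w : reduced w -> reduced (lcons l w).
Proof.
case: w => [|a w] // Hr; rewrite /lcons.
case: eqP => [_|/eqP ne]; first exact: reduced_cons Hr.
by apply/andP; split.
Qed.

Lemma foldr_reduced w x : reduced w -> reduced (foldr lcons w x).
Proof. by move=> Hw; elim: x => //= a x IH; apply: lcons_reduced. Qed.

Lemma lconsK l y : reduced y -> lcons (linv l) (lcons l y) = y.
Proof.
case: y => [|a y] /=; first by rewrite linvK eqxx.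
move=> /andP[Hy _]; case: eqP => [Ha | /eqP ne] /=.
  subst a; case: y Hy => [|b y] //= Hb.
  by rewrite linvK in Hb *; rewrite (negbTE Hb).
by rewrite linvK eqxx.
Qed.

Lemma foldr_lcons w y l : reduced w -> reduced y ->
  foldr lcons w (lcons l y) = lcons l (foldr lcons w y).
Proof.
move=> Hw; case: y => [|a y] //= Hy.
case: eqP => [-> | _] //=.
have := lconsK (linv l) (foldr_reduced y Hw).
by rewrite linvK.
Qed.

Lemma foldr_lconsA w v u : reduced w -> reduced v ->
  foldr lcons w (foldr lcons v u) = foldr lcons (foldr lcons w v) u.
Proof.
move=> Hw Hv; elim: u => //= a u IH.
by rewrite foldr_lcons // ?IH // foldr_reduced.
Qed.

Lemma foldr_lcons_nil u : reduced u -> foldr lcons [::] u = u.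
Proof.
elim: u => //= a u IH /andP[Ha Hu]; rewrite IH //.
by case: u Ha {IH Hu} => //= b u /negbTE ->.
Qed.

Definition winv (u : seq letter) : seq letter := rev (map linv u).

Lemma winv_cons a u : winv (a :: u) = rcons (winv u) (linv a).
Proof. by rewrite /winv /= rev_cons. Qed.

Lemma mulVw u : foldr lcons u (winv u) = [::].
Proof.
elim: u => //= a u IH.
by rewrite winv_cons -cats1 foldr_cat /= linvK eqxx.
Qed.

Lemma mulwV z u : reduced z -> foldr lcons (foldr lcons z (winv u)) u = z.
Proof.
elim: u z => //= a u IH z Hz.
rewrite winv_cons -cats1 foldr_cat /= IH ?lcons_reduced //.
by have := lconsK (linv a) Hz; rewrite linvK.
Qed.

Record F2 := MkF2 { fword : seq letter; fword_reduced : reduced fword }.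

HB.instance Definition _ := [isSub for fword].
HB.instance Definition _ := [Countable of F2 by <:].

Definition f2mul (u v : F2) : F2 :=
  MkF2 (foldr_reduced (fword u) (fword_reduced v)).
Definition f2one : F2 := @MkF2 [::] isT.
Definition f2inv (u : F2) : F2 :=
  MkF2 (foldr_reduced (winv (fword u)) (isT : reduced [::])).

Lemma f2mulA : associative f2mul.
Proof.
by move=> u v w; apply: val_inj; rewrite /= foldr_lconsA //; case: w; case: v.
Qed.

Lemma f2mul1 : left_id f2one f2mul.
Proof. by move=> u; apply: val_inj. Qed.

Lemma f2mulg1 : right_id f2one f2mul.
Proof. by move=> [u Hu]; apply: val_inj; rewrite /= foldr_lcons_nil. Qed.

Lemma f2mulVg : left_inverse f2one f2inv f2mul.
Proof.
move=> [u Hu]; apply: val_inj => /=.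
by rewrite foldr_lconsA //= mulVw.
Qed.

Lemma f2mulgV : right_inverse f2one f2inv f2mul.
Proof. by move=> [u Hu]; apply: val_inj => /=; rewrite mulwV. Qed.

HB.instance Definition _ :=
  isGroup.Build F2 f2mulA f2mul1 f2mulg1 f2mulVg f2mulgV.

Definition f2gen (i : bool) : F2 := @MkF2 [:: (i, false)] isT.

Definition gexpz (G : groupType) (g : G) (n : int) : G :=
  match n with
  | Posz m => (g ^+ m)%g
  | Negz m => ((g ^+ m.+1)^-1)%g
  end.

Definition prodG (G H : groupType) := (G * H)%type.
HB.instance Definition _ (G H : groupType) := Choice.on (prodG G H).

Section ProdGroup.
Variables G H : groupType.
Definition pmul (x y : prodG G H) : prodG G H := ((x.1 * y.1)%g, (x.2 * y.2)%g).
Definition pone : prodG G H := (1%g, 1%g).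
Definition pinv (x : prodG G H) : prodG G H := ((x.1)^-1%g, (x.2)^-1%g).
Lemma pmulA : associative pmul.
Proof. by move=> x y z; rewrite /pmul /= !mulgA. Qed.
Lemma pmul1 : left_id pone pmul.
Proof. by move=> [x y]; rewrite /pmul /= !mul1g. Qed.
Lemma pmulg1 : right_id pone pmul.
Proof. by move=> [x y]; rewrite /pmul /= !mulg1. Qed.
Lemma pmulVg : left_inverse pone pinv pmul.
Proof. by move=> [x y]; rewrite /pmul /= !mulVg. Qed.
Lemma pmulgV : right_inverse pone pinv pmul.
Proof. by move=> [x y]; rewrite /pmul /= !mulgV. Qed.
HB.instance Definition _ := isGroup.Build (prodG G H) pmulA pmul1 pmulg1 pmulVg pmulgV.
End ProdGroup.

(*    (adapted from multinomials' monalg.v, where the monoid of monomials   *)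
(*    is replaced by an arbitrary monoid)                                   *)

Definition galg (K : monoidType) (R : nzRingType) := {malg R[K]}.
HB.instance Definition _ K R := GRing.Lmodule.on (galg K R).

Section GalgRing.
Context (K : monoidType) (R : nzRingType).
Implicit Types (g : galg K R) (k l : K).

Definition ggone : galg K R := << (1%g : K) >>.

Local Notation "g1 *M_[ k1 , k2 ] g2" :=
  (<< g1@_k1 * g2@_k2 *g (k1 * k2)%g >> : galg K R)
  (at level 40, no associativity, format "g1  *M_[ k1 ,  k2 ]  g2").

Definition ggmul g1 g2 : galg K R :=
  \sum_(k1 <- msupp g1) \sum_(k2 <- msupp g2) g1 *M_[k1, k2] g2.

Lemma ggmull g1 g2 :
  ggmul g1 g2 = \sum_(k1 <- msupp g1) \sum_(k2 <- msupp g2) g1 *M_[k1, k2] g2.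
Proof. by []. Qed.

Lemma ggmulr g1 g2 :
  ggmul g1 g2 = \sum_(k2 <- msupp g2) \sum_(k1 <- msupp g1) g1 *M_[k1, k2] g2.
Proof. by rewrite ggmull exchange_big. Qed.

Lemma ggmullw (d1 d2 : {fset K}) g1 g2 :
  msupp g1 `<=` d1 -> msupp g2 `<=` d2 ->
  ggmul g1 g2 = \sum_(k1 <- d1) \sum_(k2 <- d2) g1 *M_[k1, k2] g2.
Proof.
move=> le_d1 le_d2; rewrite ggmull (big_fset_incl _ le_d1) /=.
  apply/eq_bigr=> k1 _; apply/big_fset_incl => // k _ /mcoeff_outdom ->.
  by rewrite mulr0 monalgU0.
move=> k _ /mcoeff_outdom g1k.
by rewrite big1 => // k' _; rewrite g1k mul0r monalgU0.
Qed.

Lemma ggmulrw (d1 d2 : {fset K}) g1 g2 : msupp g1 `<=` d1 -> msupp g2 `<=` d2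
  -> ggmul g1 g2 = \sum_(k2 <- d2) \sum_(k1 <- d1) g1 *M_[k1, k2] g2.
Proof. by move=> le_d1 le_d2; rewrite (ggmullw le_d1 le_d2) exchange_big. Qed.

Definition ggmullwl (d1 : {fset K}) {g1 g2} (le : msupp g1 `<=` d1) :=
  @ggmullw _ _ g1 g2 le (fsubset_refl _).

Definition ggmulrwl (d2 : {fset K}) {g1 g2} (le : msupp g2 `<=` d2) :=
  @ggmulrw _ _ g1 g2 (fsubset_refl _) le.

Lemma ggmul0g : left_zero 0 ggmul.
Proof. by move=> g; rewrite ggmull msupp0 big_seq_fset0. Qed.

Lemma ggmulg0 : right_zero 0 ggmul.
Proof. by move=> g; rewrite ggmulr msupp0 big_seq_fset0. Qed.

Lemma ggmulUg c k g :
  ggmul << c *g k >> g = \sum_(k' <- msupp g) << c * g@_k' *g (k * k')%g >>.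
Proof.
rewrite (ggmullw msuppU_le (fsubset_refl _)) big_seq_fset1.
by apply/eq_bigr => k' _; rewrite mcoeffUU.
Qed.

Lemma ggmulgU c k g :
  ggmul g << c *g k >> = \sum_(k' <- msupp g) << g@_k' * c *g (k' * k)%g >>.
Proof.
rewrite (ggmulrw (fsubset_refl _) msuppU_le) big_seq_fset1.
by apply/eq_bigr=> k' _; rewrite mcoeffUU.
Qed.

Lemma ggmulUU c1 c2 k1 k2 :
  ggmul << c1 *g k1 >> << c2 *g k2 >> = << c1 * c2 *g (k1 * k2)%g >> :> galg K R.
Proof. by rewrite (ggmulrw msuppU_le msuppU_le) !big_seq_fset1 !mcoeffUU. Qed.

Lemma ggmulEl1 g1 g2 :
  ggmul g1 g2 = \sum_(k1 <- msupp g1) ggmul << g1@_k1 *g k1 >> g2.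
Proof. by apply/eq_bigr=> k _; rewrite ggmulUg. Qed.

Lemma ggmulEr1 g1 g2 :
  ggmul g1 g2 = \sum_(k2 <- msupp g2) ggmul g1 << g2@_k2 *g k2 >>.
Proof. by rewrite ggmulr; apply/eq_bigr=> k _; rewrite ggmulgU. Qed.

Lemma ggmul1g : left_id ggone ggmul.
Proof.
move=> g; rewrite ggmulUg [RHS]monalgE.
by apply/eq_bigr=> kg _; rewrite mul1r mul1g.
Qed.

Lemma ggmulg1 : right_id ggone ggmul.
Proof.
move=> g; rewrite ggmulgU [RHS]monalgE.
by apply/eq_bigr=> k _; rewrite mulr1 mulg1.
Qed.

Lemma ggmulgDl : left_distributive ggmul +%R.
Proof.
move=> g1 g2 g; rewrite [in RHS](ggmullwl (fsubsetUl _ (msupp g2))).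
rewrite [in RHS](ggmullwl (fsubsetUr (msupp g1) _)) (ggmullwl (msuppD_le _ _)).
rewrite -big_split /=; apply/eq_bigr=> k1 _.
rewrite -big_split /=; apply/eq_bigr=> k2 _.
by rewrite mcoeffD mulrDl monalgUD.
Qed.

Lemma ggmulgDr : right_distributive ggmul +%R.
Proof.
move=> g g1 g2; rewrite [in RHS](ggmulrwl (fsubsetUl _ (msupp g2))).
rewrite [in RHS](ggmulrwl (fsubsetUr (msupp g1) _)) (ggmulrwl (msuppD_le _ _)).
rewrite -big_split /=; apply/eq_bigr => k1 _.
rewrite -big_split /=; apply/eq_bigr => k2 _.
by rewrite mcoeffD mulrDr monalgUD.
Qed.

Lemma ggmulA : associative ggmul.
Proof.
move=> g1 g2 g3.
rewrite [RHS](big_morph (ggmul^~ _) (fun _ _ => ggmulgDl _ _ _) (ggmul0g _)).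
rewrite ggmulEl1; apply/eq_bigr=> k1 _.
rewrite [LHS](big_morph (ggmul _) (fun _ _ => ggmulgDr _ _ _) (ggmulg0 _)).
rewrite [RHS](big_morph (ggmul^~ _) (fun _ _ => ggmulgDl _ _ _) (ggmul0g _)).
apply/eq_bigr=> k2 _.
rewrite [LHS](big_morph (ggmul _) (fun _ _ => ggmulgDr _ _ _) (ggmulg0 _)).
by rewrite ggmulEr1; apply/eq_bigr=> k3 _; rewrite !ggmulUU mulrA mulgA.
Qed.

Lemma ggoner_eq0 : ggone != 0.
Proof. by apply/eqP/malgP=> /(_ 1%g) /eqP; rewrite !mcoeffsE oner_eq0. Qed.

HB.instance Definition _ := GRing.Zmodule_isRing.Build (galg K R)
  ggmulA ggmul1g ggmulg1 ggmulgDl ggmulgDr ggoner_eq0.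

End GalgRing.


(*    V^B := k F_2 ;  V^B (x) V^B := k[F_2 x F_2]  (canonically isomorphic, *)
(*    a (x) b  <->  (a (x) 1) * (1 (x) b), X_i = X_i (x) 1, Y_i = 1 (x) X_i). *)

Definition F2sq := prodG F2 F2.

Section Objects.
Variable k : comAlgType rat.

Definition VB := galg F2 k.
Definition VB2 := galg F2sq k.

Definition gV (g : F2) : VB := << g >>.
Definition gVV (g : F2sq) : VB2 := << g >>.

Definition VX (i : bool) : VB := gV (f2gen i).
Definition VXinv (i : bool) : VB := gV (f2gen i)^-1%g.

Definition TX (i : bool) : VB2 := gVV (f2gen i, 1%g).
Definition TY (i : bool) : VB2 := gVV (1%g, f2gen i).
Definition TXinv (i : bool) : VB2 := gVV ((f2gen i)^-1%g, 1%g).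
Definition TYinv (i : bool) : VB2 := gVV (1%g, (f2gen i)^-1%g).

Definition tens1 (a : VB) : VB2 :=
  \sum_(g <- msupp a) << a@_g *g ((g, 1%g) : F2sq) >>.
Definition tens2 (b : VB) : VB2 :=
  \sum_(g <- msupp b) << b@_g *g ((1%g, g) : F2sq) >>.
Definition tens (a b : VB) : VB2 := tens1 a * tens2 b.

End Objects.

Definition gop (G : groupType) (R : nzRingType) (v : galg G R) : galg G R :=
  \sum_(g <- msupp v) << v@_g *g (g^-1)%g >>.

Definition mx3 (T : nzRingType) (l : seq (seq T)) : 'M[T]_3 :=
  \matrix_(i < 3, j < 3) nth 0 (nth [::] l i) j.

Section Rho.
Variable k : comAlgType rat.
Local Notation X := (TX k).
Local Notation Y := (TY k).
Local Notation Xi := (TXinv k).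
Local Notation Yi := (TYinv k).

Definition rhoX0 : 'M[VB2 k]_3 := mx3
  [:: [:: X false; 0; 0];
      [:: 0; (1 - X true) * X false + Yi true * Y false * Y true;
             (1 - X true) * X false * X true];
      [:: 0; X false - Yi true * Y false * Y true * Xi true;
             X false * X true]].

Definition rhoX1 : 'M[VB2 k]_3 := mx3
  [:: [:: (X true - 1) * Y true + 1; Y true * (1 - Y true); 0];
      [:: 1 - X true; Y true; 0];
      [:: 0; 0; 1]].

(* their inverses (rho being an algebra morphism, rho(X_i^{-1}) = rho(X_i)^{-1});
   with Y := Y_1^{-1} Y_0 Y_1 one has Y^{-1} = Y_1^{-1} Y_0^{-1} Y_1 *)
Definition rhoX0inv : 'M[VB2 k]_3 := mx3
  [:: [:: Xi false; 0; 0];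
      [:: 0; Yi true * Yi false * Y true * X true;
             - (Yi true * Yi false * Y true * X true * (1 - X true))];
      [:: 0; Xi true * Xi false - Yi true * Yi false * Y true;
             Xi true * Xi false * X true + Yi true * Yi false * Y true * (1 - X true)]].

Definition rhoX1inv : 'M[VB2 k]_3 := mx3
  [:: [:: Xi true; - ((1 - Y true) * Xi true); 0];
      [:: (1 - Xi true) * Yi true; (1 - Xi true) + Xi true * Yi true; 0];
      [:: 0; 0; 1]].

Definition rho_letter (l : letter) : 'M[VB2 k]_3 :=
  match l with
  | (false, false) => rhoX0
  | (true, false) => rhoX1
  | (false, true) => rhoX0inv
  | (true, true) => rhoX1inv
  end.

Definition rho_elt (g : F2) : 'M[VB2 k]_3 :=
  foldr (fun l M => rho_letter l *m M) 1%:M (fword g).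

Definition rho (v : VB k) : 'M[VB2 k]_3 :=
  \sum_(g <- msupp v) (v@_g *: (1 : VB2 k))%:M *m rho_elt g.

Definition Dmx : 'M[VB2 k]_3 := mx3
  [:: [:: Y true; 0; 0];
      [:: 0; X true; 0];
      [:: 0; 0; Xi true * Xi false * Yi true * Y false * Y true]].

Definition Dinvmx : 'M[VB2 k]_3 := mx3
  [:: [:: Yi true; 0; 0];
      [:: 0; Xi true; 0];
      [:: 0; 0; Yi true * Yi false * Y true * X false * X true]].

Definition rrho (v : VB k) : 'M[VB2 k]_3 :=
  Dinvmx *m map_mx (@gop F2sq k) (rho (gop v))^T *m Dmx.

Definition rrow : 'M[VB2 k]_(1, 3) :=
  \matrix_(i < 1, j < 3) nth 0 [:: Y true; - (X true * Y true); 0] j.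

Definition rcol : 'M[VB2 k]_(3, 1) :=
  \matrix_(i < 3, j < 1) (Yi true * nth 0 [:: X true - 1; 1 - Y true; 0] i).

Definition DeltaOmat (c : k) (v : VB k) : VB2 k :=
  c *: (1 : VB2 k) + (rrow *m rrho v *m rcol) 0 0.

End Rho.

(* the paper's summation convention: sum_{j=p}^{q} f(j) is
   f(p)+...+f(q) if q > p-1, 0 if q = p-1, -f(p-1)-...-f(q+1) if q < p-1 *)
Definition csum (T : zmodType) (p q : int) (f : int -> T) : T :=
  if (p - 1 <= q)%R then \sum_(i < absz (q - p + 1)%R) f (p + i%:Z)%R
  else - \sum_(i < absz (p - 1 - q)%R) f (q + 1 + i%:Z)%R.

Section W.
Variable k : comAlgType rat.

Definition inW (w : VB k) : Prop :=
  exists (c : k) (v : VB k), w = c *: (1 : VB k) + v * (VX k true - 1).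

Definition Wgen (n : int) : VB k :=
  gV k (gexpz (f2gen false) n) * (VX k true - 1).

End W.

(* Main.v *)
Require Import Defs.
From HB Require Import structures.
From mathcomp Require Import all_boot all_algebra.
From mathcomp Require Import finmap.
From mathcomp.multinomials Require Import monalg.
From mathcomp Require Import zify.
Import GRing.Theory.
Local Open Scope ring_scope.

Set Implicit Arguments.
Unset Strict Implicit.
Unset Printing Implicit Defensive.

(* Both sides are k-linear in v, so it suffices to compare them at v = g in F_2.
   The map r-rho is multiplicative and r-rho(X_1) - 1 = r-col . r-row, so that
   q(v) := r-row r-rho(v) r-col satisfies q(g) q(h) = q(g X_1 h) - q(g h), which
   is the relation satisfied by Delta(g (X_1 - 1)). It remains to compare the two
   sides at X_1^-1 and X_0^n. For the latter, r-rho(X_0)^n r-col is computed in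
   closed form: with z = Y_1^-1 Y_0 Y_1, which commutes with X_0 and X_1, its
   entries are expressed by t_n = Y_0^n - sum_{j=1}^{n-1} X_0^j (X_1 - 1) Y_0^(n-j),
   and t_(n+1) = X_0 t_n + Y_0^(n+1) - X_0 X_1 Y_0^n. *)

(** * Linear maps on a monoid algebra *)

Definition linext (G : monoidType) (R : nzRingType) (V : lmodType R)
    (f : G -> V) (v : galg G R) : V := \sum_(g <- msupp v) v@_g *: f g.

Section LinearExtension.
Variables (G : monoidType) (R : nzRingType).
Implicit Types (g : G) (c : R) (u v : galg G R).

Section Linear.
Variables (V : lmodType R) (f : G -> V).

Lemma linextEw (d : {fset G}) v :
  (msupp v `<=` d)%fset -> linext f v = \sum_(g <- d) v@_g *: f g.
Proof.
move=> le_vd; apply: big_fset_incl => // g _ /mcoeff_outdom ->.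
by rewrite scale0r.
Qed.

Lemma linext_is_linear : linear (linext f).
Proof.
move=> c u v; pose d := (msupp u `|` msupp v)%fset.
have le_ud : (msupp u `<=` d)%fset by apply: fsubsetUl.
have le_vd : (msupp v `<=` d)%fset by apply: fsubsetUr.
have le_cd : (msupp (c *: u + v) `<=` d)%fset.
  by apply: fsubset_trans (msuppD_le _ _) _; apply: fsetSU; apply: msuppZ_le.
rewrite (linextEw le_ud) (linextEw le_vd) (linextEw le_cd) scaler_sumr.
rewrite -big_split /=; apply: eq_bigr => g _.
by rewrite mcoeffD mcoeffZ scalerDl scalerA.
Qed.

HB.instance Definition _ :=
  GRing.isLinear.Build R (galg G R) V *:%R (linext f) linext_is_linear.

Lemma linextB : {morph linext f : u v / u - v}.
Proof. exact: raddfB. Qed.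

Lemma linextU c g : linext f (<< c *g g >> : galg G R) = c *: f g.
Proof. by rewrite (linextEw (@msuppU_le _ _ g c)) big_seq_fset1 mcoeffUU. Qed.

End Linear.

Lemma galgU_mul c1 c2 g1 g2 :
  (<< c1 *g g1 >> : galg G R) * << c2 *g g2 >> = << c1 * c2 *g (g1 * g2)%g >>.
Proof. exact: ggmulUU. Qed.

Lemma galgU1_mul g1 g2 :
  (<< g1 >> : galg G R) * << g2 >> = << (g1 * g2)%g >>.
Proof. by rewrite galgU_mul mulr1. Qed.

Lemma scale_galgU c d g : c *: (<< d *g g >> : galg G R) = << c * d *g g >>.
Proof. by apply/malgP => h; rewrite mcoeffZ !mcoeffU mulrnAr. Qed.

Lemma linext_id v : linext (fun g => << g >> : galg G R) v = v.
Proof.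
by rewrite [RHS]monalgE; apply: eq_bigr => g _; rewrite scale_galgU mulr1.
Qed.

End LinearExtension.

(** Linearity is a hypothesis on bare functions so that the lemma applies to v |-> Delta(v (X_1 -
    1)), whose linearity comes from the assumptions on Delta. *)
Lemma galg_linear_ext (G : monoidType) (R : nzRingType) (V : lmodType R)
    (f f' : galg G R -> V) :
  linear f -> linear f' -> (forall g, f << g >> = f' << g >>) -> f =1 f'.
Proof.
move=> fL fL' eq_ff' v; rewrite -(linext_id v) /linext.
have lin0 (h : galg G R -> V) : linear h -> h 0 = 0.
  by move=> hL; have := hL (-1) 0 0; rewrite scaler0 addr0 scaleN1r addNr.
elim: (enum_fset (msupp v)) => [|g s IH]; first by rewrite big_nil !lin0.
by rewrite big_cons fL fL' eq_ff' IH.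
Qed.

Section CommutativeScalars.
Variables (G : monoidType) (R : comNzRingType).
Implicit Types (g : G) (c : R) (u v : galg G R).

Lemma galg_scaleAl c u v : c *: (u * v) = c *: u * v.
Proof.
rewrite -[u]linext_id -[v]linext_id /linext mulr_suml scaler_sumr.
rewrite [in RHS]scaler_sumr mulr_suml; apply: eq_bigr => g _.
rewrite !mulr_sumr scaler_sumr; apply: eq_bigr => h _.
by rewrite !scale_galgU !galgU_mul scale_galgU !mulr1 mulrA.
Qed.

Lemma galg_scaleAr c u v : c *: (u * v) = u * (c *: v).
Proof.
rewrite -[u]linext_id -[v]linext_id /linext mulr_suml scaler_sumr.
rewrite [in RHS]scaler_sumr mulr_suml; apply: eq_bigr => g _.
rewrite !mulr_sumr scaler_sumr; apply: eq_bigr => h _.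
by rewrite !scale_galgU !galgU_mul scale_galgU !mulr1 mulrCA.
Qed.

HB.instance Definition _ :=
  GRing.Lmodule_isLalgebra.Build R (galg G R) galg_scaleAl.
HB.instance Definition _ :=
  GRing.Lalgebra_isAlgebra.Build R (galg G R) galg_scaleAr.

End CommutativeScalars.

(** * The antiautomorphism induced by inversion *)

Section Gop.
Variables (G : groupType) (R : comNzRingType).
Implicit Types (g : G) (c : R) (u v : galg G R).

Lemma gopE v : gop v = linext (fun g => << (g^-1)%g >> : galg G R) v.
Proof. by apply: eq_bigr => g _; rewrite scale_galgU mulr1. Qed.

Lemma gop_is_linear : linear (@gop G R).
Proof. by move=> c u v; rewrite !gopE linearP. Qed.

HB.instance Definition _ :=
  GRing.isLinear.Build R (galg G R) (galg G R) *:%R (@gop G R) gop_is_linear.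

Lemma gopZ c v : gop (c *: v) = c *: gop v.
Proof. exact: linearZZ. Qed.

Lemma gopU c g : gop (<< c *g g >> : galg G R) = << c *g (g^-1)%g >>.
Proof. by rewrite gopE linextU scale_galgU mulr1. Qed.

Lemma gop1 : gop (1 : galg G R) = 1.
Proof. by apply: etrans (gopU 1 1%g) _; rewrite invg1. Qed.

Lemma gopM u v : gop (u * v) = gop v * gop u.
Proof.
rewrite -(linext_id u) -(linext_id v) /linext mulr_suml !linear_sum mulr_sumr.
apply: eq_bigr => g _; rewrite mulr_sumr mulr_suml linear_sum.
apply: eq_bigr => h _ /=; rewrite !scale_galgU galgU_mul !gopU galgU_mul.
by rewrite !mulr1 mulrC invgM.
Qed.

(** Over a noncommutative ring transposition alone does not reverse products: the entries stay in
    the wrong order, and the antiautomorphism swaps them. *)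
Lemma map_gop_trmxM m n p (A : 'M[galg G R]_(m, n)) (B : 'M_(n, p)) :
  map_mx (@gop G R) (A *m B)^T =
  map_mx (@gop G R) B^T *m map_mx (@gop G R) A^T.
Proof.
apply/matrixP => i j; rewrite !mxE linear_sum /=; apply: eq_bigr => l _.
by rewrite gopM !mxE.
Qed.

Lemma map_gop_trmx1 n : map_mx (@gop G R) (1%:M : 'M_n)^T = 1%:M.
Proof.
apply/matrixP => i j; rewrite !mxE eq_sym.
by case: eqP => _; rewrite ?gop1 ?linear0.
Qed.

End Gop.

(** * Explicit 3 x 3 matrices *)

Section Mx3.
Variable T : nzRingType.

Definition cv3 (s : seq T) : 'cV[T]_3 := \col_(i < 3) nth 0 s i.

Lemma mx3M (a11 a12 a13 a21 a22 a23 a31 a32 a33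
            b11 b12 b13 b21 b22 b23 b31 b32 b33 : T) :
  mx3 [:: [:: a11; a12; a13]; [:: a21; a22; a23]; [:: a31; a32; a33]] *m
  mx3 [:: [:: b11; b12; b13]; [:: b21; b22; b23]; [:: b31; b32; b33]] =
  mx3 [:: [:: a11 * b11 + (a12 * b21 + a13 * b31);
              a11 * b12 + (a12 * b22 + a13 * b32);
              a11 * b13 + (a12 * b23 + a13 * b33)];
          [:: a21 * b11 + (a22 * b21 + a23 * b31);
              a21 * b12 + (a22 * b22 + a23 * b32);
              a21 * b13 + (a22 * b23 + a23 * b33)];
          [:: a31 * b11 + (a32 * b21 + a33 * b31);
              a31 * b12 + (a32 * b22 + a33 * b32);
              a31 * b13 + (a32 * b23 + a33 * b33)]].
Proof.
apply/matrixP => -[[|[|[|//]]] ?] [[|[|[|//]]] ?];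
by rewrite !mxE !big_ord_recl big_ord0 addr0 !mxE.
Qed.

Lemma mx3_cv3 (a11 a12 a13 a21 a22 a23 a31 a32 a33 b1 b2 b3 : T) :
  mx3 [:: [:: a11; a12; a13]; [:: a21; a22; a23]; [:: a31; a32; a33]] *m
  cv3 [:: b1; b2; b3] =
  cv3 [:: a11 * b1 + (a12 * b2 + a13 * b3);
          a21 * b1 + (a22 * b2 + a23 * b3);
          a31 * b1 + (a32 * b2 + a33 * b3)].
Proof.
apply/matrixP => -[[|[|[|//]]] ?] j;
by rewrite !mxE !big_ord_recl big_ord0 addr0 !mxE.
Qed.

Lemma mx3_1 : 1%:M = mx3 [:: [:: 1; 0; 0]; [:: 0; 1; 0]; [:: 0; 0; 1]] :> 'M[T]_3.
Proof.
by apply/matrixP => -[[|[|[|//]]] ?] [[|[|[|//]]] ?]; rewrite !mxE.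
Qed.

End Mx3.

(** * Cancellation in signed sums *)

Lemma zmod_cancelR (V : zmodType) (s s' t : V) : s = s' - t -> s' = 0 -> s + t = 0.
Proof. by move=> -> ->; rewrite subrK. Qed.

Lemma zmod_cancelN (V : zmodType) (s s' t : V) : s = s' + t -> s' = 0 -> s - t = 0.
Proof. by move=> -> ->; rewrite addrK. Qed.

Lemma zmod_skip (V : zmodType) (s s' t w : V) : s = s' + t -> s + w = s' + w + t.
Proof. by move=> ->; rewrite addrAC. Qed.

(** On a goal [s = ?s' + u], searches the left-nested sum [s] from its right end for the summand
    [u]; [?s'] becomes the sum of the other summands, or [0] if there is none. *)
Ltac zmod_find same :=
  lazymatch goal with
  | |- @GRing.add _ _ ?t = @GRing.add _ _ ?u =>
      tryif same t u then exact (erefl _)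
      else (eapply zmod_skip; zmod_find same)
  | |- _ => exact (esym (add0r _))
  end.

Ltac syntactic t u := constr_eq t u.
Ltac convertible t u := unify t u.
Ltac zmod_search := first [zmod_find syntactic | zmod_find convertible].

Ltac zmod_loop :=
  lazymatch goal with
  | |- 0 = 0 => exact (erefl _)
  | |- _ - _ = 0 => eapply zmod_cancelN; [zmod_search | zmod_loop]
  | |- _ + _ = 0 => eapply zmod_cancelR; [zmod_search | zmod_loop]
  end.

(* The [ring] tactic is restricted to commutative rings; [zmod] settles an
   identity between signed sums of atoms by cancelling each summand against
   its opposite. *)
Ltac zmod :=
  apply/eqP; rewrite -subr_eq0; apply/eqP;
  rewrite ?(opprD, opprK, addrA, oppr0, addr0, add0r); zmod_loop.

(** * Matrix identities for the images of the generators *)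

(* The matrices of the statement over an abstract ring, with [m] playing the
   embedding of the group [F_2 x F_2] and [op] the antiautomorphism: in the
   concrete group algebra, every rewrite attempt unfolds the ring operations. *)
Section BlockIdentities.
Variables (T : nzRingType) (G H : groupType) (m : G * H -> T).
Hypothesis m1 : m (1%g, 1%g) = 1.
Hypothesis mM : forall g g' h h',
  m (g, h) * m (g', h') = m ((g * g')%g, (h * h')%g).
Variable op : {additive T -> T}.
Hypothesis op1 : op 1 = 1.
Hypothesis opM : forall u v, op (u * v) = op v * op u.
Hypothesis opm : forall g h, op (m (g, h)) = m ((g^-1)%g, (h^-1)%g).
Variables (x0 x1 : G) (y0 y1 : H).

Local Notation X0 := (m (x0, 1%g)).
Local Notation X1 := (m (x1, 1%g)).
Local Notation Y0 := (m (1%g, y0)).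
Local Notation Y1 := (m (1%g, y1)).
Local Notation X0' := (m (x0^-1%g, 1%g)).
Local Notation X1' := (m (x1^-1%g, 1%g)).
Local Notation Y0' := (m (1%g, y0^-1%g)).
Local Notation Y1' := (m (1%g, y1^-1%g)).

Lemma mMr u g g' h h' :
  u * m (g, h) * m (g', h') = u * m ((g * g')%g, (h * h')%g).
Proof. by rewrite -mulrA mM. Qed.

Ltac monomials :=
  rewrite ?(mul0r, mulr0, oppr0, add0r, addr0);
  rewrite ?(mulrDl, mulrDr, mulrN, mulNr, opprD, opprK, mulrA, mul1r, mulr1);
  rewrite ?(mM, mMr) ?(mulgA, mulg1, mul1g, invg1);
  rewrite ?(mulgK, mulgVK, mulgV, mulVg, mulg1, mul1g) ?m1 ?(mul1r, mulr1).

Ltac mx3_monomials :=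
  congr mx3; congr [:: _; _; _]; congr [:: _; _; _]; monomials; zmod.

Let M0 := mx3 [:: [:: X0; 0; 0];
  [:: 0; (1 - X1) * X0 + Y1' * Y0 * Y1; (1 - X1) * X0 * X1];
  [:: 0; X0 - Y1' * Y0 * Y1 * X1'; X0 * X1]].

Let M1 := mx3 [:: [:: (X1 - 1) * Y1 + 1; Y1 * (1 - Y1); 0];
  [:: 1 - X1; Y1; 0];
  [:: 0; 0; 1]].

Let M0inv := mx3 [:: [:: X0'; 0; 0];
  [:: 0; Y1' * Y0' * Y1 * X1; - (Y1' * Y0' * Y1 * X1 * (1 - X1))];
  [:: 0; X1' * X0' - Y1' * Y0' * Y1;
         X1' * X0' * X1 + Y1' * Y0' * Y1 * (1 - X1)]].

Let M1inv := mx3 [:: [:: X1'; - ((1 - Y1) * X1'); 0];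
  [:: (1 - X1') * Y1'; (1 - X1') + X1' * Y1'; 0];
  [:: 0; 0; 1]].

Let D := mx3 [:: [:: Y1; 0; 0];
  [:: 0; X1; 0];
  [:: 0; 0; X1' * X0' * Y1' * Y0 * Y1]].

Let Dinv := mx3 [:: [:: Y1'; 0; 0];
  [:: 0; X1'; 0];
  [:: 0; 0; Y1' * Y0' * Y1 * X0 * X1]].

Let row : 'M[T]_(1, 3) :=
  \matrix_(i < 1, j < 3) nth 0 [:: Y1; - (X1 * Y1); 0] j.

Let col : 'M[T]_(3, 1) :=
  \matrix_(i < 3, j < 1) (Y1' * nth 0 [:: X1 - 1; 1 - Y1; 0] i).

(** The shape of the columns r-rho(X_0)^n r-col, with [p], [q], [t] in the roles of Y_0^n, X_0^n and
    t_n. *)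
Let V (p q t : T) : 'cV[T]_3 :=
  cv3 [:: Y1' * q * (X1 - 1); X1' * Y1' * t * (1 - Y1);
          Y1' * Y0' * Y1 * X0 * X1 * Y1' * (X1' * t - p) * (1 - Y1)].

Lemma block_X0_mulV : M0 *m M0inv = 1%:M.
Proof. by rewrite mx3M mx3_1; mx3_monomials. Qed.

Lemma block_X0_mulVl : M0inv *m M0 = 1%:M.
Proof. by rewrite mx3M mx3_1; mx3_monomials. Qed.

Lemma block_X1_mulV : M1 *m M1inv = 1%:M.
Proof. by rewrite mx3M mx3_1; mx3_monomials. Qed.

Lemma block_X1_mulVl : M1inv *m M1 = 1%:M.
Proof. by rewrite mx3M mx3_1; mx3_monomials. Qed.

Lemma block_D_mulV : D *m Dinv = 1%:M.
Proof. by rewrite mx3M mx3_1; mx3_monomials. Qed.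

Lemma block_D_mulVl : Dinv *m D = 1%:M.
Proof. by rewrite mx3M mx3_1; mx3_monomials. Qed.

Lemma map_mx3_trmx (a11 a12 a13 a21 a22 a23 a31 a32 a33 : T) :
  map_mx op
    (mx3 [:: [:: a11; a12; a13]; [:: a21; a22; a23]; [:: a31; a32; a33]])^T =
  mx3 [:: [:: op a11; op a21; op a31]; [:: op a12; op a22; op a32];
          [:: op a13; op a23; op a33]].
Proof.
by apply/matrixP => -[[|[|[|//]]] ?] [[|[|[|//]]] ?]; rewrite !mxE.
Qed.

Ltac expand_op :=
  rewrite ?(raddfB, raddfD, raddfN, raddf0, opM, op1, opm, invg1, invgK).

(** [M1inv] occurs because r-rho(X_1) is built from rho(op(X_1)) = rho(X_1^-1). The rank one form of
    the result is what makes [mulmx_rank1] applicable. *)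
Lemma block_R1 : Dinv *m map_mx op M1inv^T *m D = col *m row + 1%:M.
Proof.
have -> : col *m row + 1%:M =
    mx3 [:: [:: Y1' * (X1 - 1) * Y1 + 1; - (Y1' * (X1 - 1) * (X1 * Y1)); 0];
            [:: Y1' * (1 - Y1) * Y1; - (Y1' * (1 - Y1) * (X1 * Y1)) + 1; 0];
            [:: 0; 0; 1]].
  apply/matrixP => -[[|[|[|//]]] ?] [[|[|[|//]]] ?];
  rewrite !mxE big_ord1 !mxE /=; monomials; zmod.
by rewrite map_mx3_trmx !mx3M; expand_op; mx3_monomials.
Qed.

Lemma block_R0_mx : Dinv *m map_mx op M0inv^T *m D =
  mx3 [:: [:: Y1' * X0 * Y1; 0; 0];
          [:: 0; X1' * (Y1' * Y0 * Y1);
              X1' * (Y1' * Y0 * Y1)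
              - X1' * (Y1' * Y0 * Y1) * X1' * X0' * (Y1' * Y0 * Y1)];
          [:: 0; X0 - X0 * X1;
              X0 + Y1' * Y0 * Y1 - Y1' * Y0 * Y1 * X0 * X1' * X0']].
Proof. by rewrite map_mx3_trmx !mx3M; expand_op; mx3_monomials. Qed.

(** The parameters are only multiplied on the left by group elements. In the second and third
    entries, z = Y_1^-1 Y_0 Y_1 moves past X_0 and X_1, and z Y_1^-1 = Y_1^-1 Y_0 produces the term
    [Y0 * p]. *)
Lemma block_R0 (p q t : T) : Dinv *m map_mx op M0inv^T *m D *m V p q t =
  V (Y0 * p) (X0 * q) (X0 * t + Y0 * p - X0 * X1 * p).
Proof.
rewrite block_R0_mx mx3_cv3.
by congr cv3; congr [:: _; _; _]; monomials; zmod.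
Qed.

(** The case n = 0: t_0 = X_1, so the factor X_1^-1 t - p kills the third entry. *)
Lemma block_col : col = V 1 1 X1.
Proof.
apply/matrixP => -[[|[|[|//]]] ?] j; rewrite !mxE /=; monomials; zmod.
Qed.

Lemma block_row (p q t : T) :
  (row *m V p q t) 0 0 = q * (X1 - 1) + t * (Y1 - 1).
Proof.
rewrite !mxE !big_ord_recl big_ord0 !mxE /=; monomials; zmod.
Qed.

End BlockIdentities.

(** * Sums with the extended convention on bounds *)

Section Csum.

Lemma csum_addn (T : zmodType) (p : int) (m : nat) (f : int -> T) :
  csum p (p + m%:Z) f = \sum_(i < m.+1) f (p + i%:Z).
Proof.
rewrite /csum; have -> : (p - 1 <= p + m%:Z)%R by lia.
by have -> : absz (p + m%:Z - p + 1)%R = m.+1 by lia.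
Qed.

Lemma csum_subn (T : zmodType) (p : int) (m : nat) (f : int -> T) :
  csum p (p - m%:Z - 1) f = - \sum_(i < m) f (p - m%:Z + i%:Z).
Proof.
rewrite /csum; case: ifP => Hm.
  (* The upper bound p - 1 belongs to the first branch of [csum], as an empty sum. *)
  have -> : m = 0%N by lia.
  have -> : absz (p - 0%:Z - 1 - p + 1)%R = 0%N by lia.
  by rewrite !big_ord0 oppr0.
have -> : absz (p - 1 - (p - m%:Z - 1))%R = m by lia.
by congr (- _); apply: eq_bigr => i _; congr f; lia.
Qed.

(** The sign convention makes this hold for all integer bounds: when q < p, moving the lower bound
    up adds the term -f(p), which cancels f(p). The recursion for t_n thus needs no case distinction
    on n. *)
Lemma csum_recl (T : zmodType) (p q : int) (f : int -> T) :
  csum p q f = f p + csum (p + 1) q f.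
Proof.
have [m [->|->]] : exists m : nat, q = p + m%:Z \/ q = p - m%:Z - 1.
  by case: (boolP (p <= q)%R) => Hpq;
    [exists (absz (q - p)%R) | exists (absz (p - 1 - q)%R)]; lia.
- rewrite csum_addn big_ord_recl addr0.
  case: m => [|m].
    rewrite big_ord0 (_ : p + 0%:Z = p + 1 - 0%:Z - 1); last by lia.
    by rewrite csum_subn big_ord0 oppr0.
  rewrite (_ : p + m.+1%:Z = p + 1 + m%:Z); last by lia.
  rewrite csum_addn; congr (_ + _); apply: eq_bigr => i _; congr f.
  by rewrite lift0; lia.
- rewrite csum_subn (_ : p - m%:Z - 1 = p + 1 - m.+1%:Z - 1); last by lia.
  rewrite csum_subn big_ord_recr /= opprD addrCA.
  rewrite (_ : p + 1 - m.+1%:Z + m%:Z = p); last by lia.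
  rewrite subrr addr0; congr (- _); apply: eq_bigr => i _; congr f; lia.
Qed.

Lemma csum_shift (T : zmodType) (p q : int) (f : int -> T) :
  csum (p + 1) (q + 1) f = csum p q (fun j => f (j + 1)).
Proof.
rewrite /csum (_ : (p + 1 - 1 <= q + 1)%R = (p - 1 <= q)%R); last by lia.
rewrite (_ : q + 1 - (p + 1) + 1 = q - p + 1); last by lia.
rewrite (_ : p + 1 - 1 - (q + 1) = p - 1 - q); last by lia.
by case: ifP => _; [|congr (- _)]; apply: eq_bigr => i _; congr f; lia.
Qed.

Lemma eq_csum (T : zmodType) (p q : int) (f g : int -> T) :
  f =1 g -> csum p q f = csum p q g.
Proof.
by move=> fg; rewrite /csum; case: ifP => _; [|congr (- _)];
  apply: eq_bigr => i _.
Qed.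

Lemma mulr_csumr (T : nzRingType) (p q : int) (u : T) (f : int -> T) :
  u * csum p q f = csum p q (fun j => u * f j).
Proof. by rewrite /csum; case: ifP => _; rewrite ?mulrN mulr_sumr. Qed.

Lemma mulr_csuml (T : nzRingType) (p q : int) (u : T) (f : int -> T) :
  csum p q f * u = csum p q (fun j => f j * u).
Proof. by rewrite /csum; case: ifP => _; rewrite ?mulNr mulr_suml. Qed.

End Csum.

(** * Integer powers in a group *)

Lemma gexpzS (G : groupType) (g : G) n : gexpz g (n + 1) = (g * gexpz g n)%g.
Proof.
case: n => [n|[|n]].
- by rewrite -PoszD addn1 /= expgS.
- by rewrite /= expg1 mulgV.
rewrite (_ : Negz n.+1 + 1 = Negz n); last by lia.
by rewrite /= [(g ^+ n.+2)%g]expgSr invgM mulVKg.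
Qed.

Lemma gexpzSr (G : groupType) (g : G) n : gexpz g (n + 1) = (gexpz g n * g)%g.
Proof.
case: n => [n|[|n]].
- by rewrite -PoszD addn1 /= expgSr.
- by rewrite /= expg1 mulVg.
rewrite (_ : Negz n.+1 + 1 = Negz n); last by lia.
by rewrite /= [(g ^+ n.+2)%g]expgS invgM mulgVK.
Qed.

(** * Matrices over a noncommutative ring *)

Lemma mulmx_conj (T : nzRingType) n (A B D Dinv : 'M[T]_n) :
  D *m Dinv = 1%:M ->
  Dinv *m (A *m B) *m D = Dinv *m A *m D *m (Dinv *m B *m D).
Proof.
by move=> DK; rewrite -!mulmxA [D *m (_ *m _)]mulmxA DK mul1mx.
Qed.

Lemma mulmx_algC (R : comNzRingType) (T : algType R) m n (c : R)
  (A : 'M[T]_(m, n)) : A *m (c%:A)%:M = (c%:A)%:M *m A.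
Proof.
rewrite mul_scalar_mx; apply/matrixP => i j; rewrite !mxE (bigD1 j) //=.
rewrite big1 => [|l /negbTE nlj]; last by rewrite !mxE nlj mulr0n mulr0.
by rewrite !mxE eqxx mulr1n addr0 mulr_algr mulr_algl.
Qed.

(** The scalar stands to the right of [A] because [map_gop_trmxM] reverses the product in
    [rho_linear]. *)
Lemma mulmx_sandwich_linear (R : comNzRingType) (T : algType R) m n p q r s
  (c : R) (P' : 'M[T]_(m, n)) (P : 'M_(n, p)) (A B : 'M_(p, q)) (Q : 'M_(q, r))
  (Q' : 'M_(r, s)) i j :
  (P' *m (P *m (A *m (c%:A)%:M + B) *m Q) *m Q') i j =
  c *: (P' *m (P *m A *m Q) *m Q') i j + (P' *m (P *m B *m Q) *m Q') i j.
Proof.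
rewrite !mulmxDr !mulmxDl !mulmxDr !mulmxDl mxE; congr (_ + _).
rewrite mulmx_algC !mulmxA !mulmx_algC !mul_scalar_mx -!scalemxAl mxE.
by rewrite mulr_algl.
Qed.

(** Multiplying the two 1 x 1 matrices puts [col *m row] between [A] and [B]; the added identity is
    compensated by the subtracted term. *)
Lemma mulmx_rank1 (T : nzRingType) n (row : 'rV[T]_n) (col : 'cV_n)
    (A B : 'M_n) :
  (row *m A *m col) 0 0 * (row *m B *m col) 0 0 =
  (row *m (A *m (col *m row + 1%:M) *m B) *m col) 0 0
  - (row *m (A *m B) *m col) 0 0.
Proof.
rewrite !(mulmxDr, mulmxDl) mulmx1 [X in _ = X - _]mxE addrK.
have -> : row *m (A *m (col *m row) *m B) *m col =
    (row *m A *m col) *m (row *m B *m col) by rewrite !mulmxA.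
by rewrite [RHS]mxE big_ord1.
Qed.

(** Since [rep g] is invertible, the one-step recursion also runs backwards and reaches the negative
    exponents. *)
Lemma rep_gexpz (T : nzRingType) (G : groupType) m n (rep : G -> 'M[T]_m)
    (g : G) (v : int -> 'M[T]_(m, n)) :
  rep 1%g = 1%:M -> {morph rep : x y / (x * y)%g >-> x *m y} ->
  (forall i, rep g *m v i = v (i + 1)) ->
  forall i, rep (gexpz g i) *m v 0 = v i.
Proof.
move=> rep1 repM vS; have vP i : rep g^-1%g *m v (i + 1) = v i.
  by rewrite -vS mulmxA -repM mulVg rep1 mul1mx.
elim/int_rect => [|n' IH|n' IH]; first by rewrite rep1 mul1mx.
  by rewrite -addn1 PoszD gexpzS repM -mulmxA IH vS.
rewrite -(vP (- n'.+1%:Z)) (_ : - n'.+1%:Z + 1 = - n'%:Z); last by lia.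
rewrite -IH mulmxA -repM; congr (rep _ *m _).
by rewrite (_ : - n'%:Z = - n'.+1%:Z + 1) ?gexpzS ?mulKg //; lia.
Qed.

(** * Multiplicativity of rho and r-rho, and the powers of r-rho(X_0) *)

Section RhoMorphism.
Variable k : comAlgType rat.

Definition gopvv : {additive VB2 k -> VB2 k} := @gop F2sq k.

Lemma gVV1 : gVV k (1%g, 1%g) = 1. Proof. by []. Qed.

Lemma gVVM g g' h h' :
  gVV k (g, h) * gVV k (g', h') = gVV k ((g * g')%g, (h * h')%g).
Proof. exact: galgU1_mul. Qed.

Lemma gop_gVV g h : gop (gVV k (g, h)) = gVV k ((g^-1)%g, (h^-1)%g).
Proof. exact: gopU. Qed.

Lemma rho_letter_mulV l : rho_letter k l *m rho_letter k (linv l) = 1%:M.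
Proof.
case: l => [[] []].
- exact: (block_X1_mulVl gVV1 gVVM).
- exact: (block_X1_mulV gVV1 gVVM).
- exact: (block_X0_mulVl gVV1 gVVM).
- exact: (block_X0_mulV gVV1 gVVM).
Qed.

Definition rho_word (w : seq letter) : 'M[VB2 k]_3 :=
  foldr (fun l M => rho_letter k l *m M) 1%:M w.

Lemma rho_word_cons l w : rho_word (l :: w) = rho_letter k l *m rho_word w.
Proof. by []. Qed.

(** A cancellation performed by [lcons] is matched by the matrices of a letter and its inverse being
    inverse to each other; this gives multiplicativity on reduced words. *)
Lemma rho_word_lcons l w : rho_word (lcons l w) = rho_letter k l *m rho_word w.
Proof.
case: w => [|l' w] //; rewrite /lcons; case: eqP => [->|_] //.
by rewrite rho_word_cons mulmxA rho_letter_mulV mul1mx.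
Qed.

Lemma rho_word_foldr_lcons u w :
  rho_word (foldr lcons w u) = rho_word u *m rho_word w.
Proof.
elim: u => [|l u IH]; first by rewrite mul1mx.
by rewrite rho_word_cons -mulmxA -IH -rho_word_lcons.
Qed.

Lemma rho_eltM g h : rho_elt k (g * h)%g = rho_elt k g *m rho_elt k h.
Proof. exact: rho_word_foldr_lcons. Qed.

Lemma rho_elt1 : rho_elt k 1%g = 1%:M. Proof. by []. Qed.

Definition rrho_elt (g : F2) : 'M[VB2 k]_3 :=
  Dinvmx k *m map_mx (@gop F2sq k) (rho_elt k g^-1%g)^T *m Dmx k.

Lemma rrho_elt1 : rrho_elt 1%g = 1%:M.
Proof.
rewrite /rrho_elt invg1 rho_elt1 map_gop_trmx1 mulmx1.
exact: (block_D_mulVl gVV1 gVVM).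
Qed.

(** Inversion in F_2 reverses products, and so does [gop] combined with transposition; the two
    reversals cancel, and conjugation by D preserves products. *)
Lemma rrho_eltM g h : rrho_elt (g * h)%g = rrho_elt g *m rrho_elt h.
Proof.
rewrite /rrho_elt invgM rho_eltM map_gop_trmxM; apply: mulmx_conj.
exact: (block_D_mulV gVV1 gVVM).
Qed.

Let x0 := f2gen false.
Let x1 := f2gen true.

Lemma rrho_elt_x1 : rrho_elt x1 = rcol k *m rrow k + 1%:M.
Proof.
have rho_x1V : rho_elt k x1^-1%g = rhoX1inv k by rewrite /rho_elt /= mulmx1.
rewrite /rrho_elt rho_x1V.
exact: (block_R1 gVV1 gVVM (op := gopvv) (@gop1 _ _) (@gopM _ _) gop_gVV).
Qed.

Lemma rhoE v i j : rho v i j = linext (fun g => rho_elt k g i j) v.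
Proof.
rewrite /rho summxE; apply: eq_bigr => g _.
by rewrite mul_scalar_mx !mxE mulr_algl.
Qed.

Lemma rho_linear (c : k) (u v : VB k) :
  rho (c *: u + v) = (c%:A)%:M *m rho u + rho v.
Proof.
apply/matrixP => i j; rewrite mul_scalar_mx rhoE linext_is_linear -!rhoE.
by rewrite [RHS]mxE [X in _ = X + _]mxE mulr_algl.
Qed.

Lemma rhoU g : rho (gV k g) = rho_elt k g.
Proof. by apply/matrixP => i j; rewrite rhoE linextU scale1r. Qed.

Definition row_rrho_col (v : VB k) : VB2 k := (rrow k *m rrho v *m rcol k) 0 0.

Lemma map_gop_algC (c : k) n :
  map_mx (@gop F2sq k) (c%:A)%:M = (c%:A)%:M :> 'M_n.
Proof.
have gop_algC : gop (c%:A : VB2 k) = c%:A by rewrite gopZ gop1.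
apply/matrixP => i j; rewrite !mxE; case: (i == j).
  exact: gop_algC.
exact: linear0.
Qed.

Lemma row_rrho_col_linear : linear row_rrho_col.
Proof.
move=> c u v; rewrite /row_rrho_col /rrho gop_is_linear rho_linear.
rewrite raddfD map_mxD map_gop_trmxM tr_scalar_mx map_gop_algC.
exact: mulmx_sandwich_linear.
Qed.

Lemma row_rrho_colU g : row_rrho_col (gV k g) = (rrow k *m rrho_elt g *m rcol k) 0 0.
Proof. by rewrite /row_rrho_col /rrho gopU rhoU. Qed.

Lemma row_rrho_colM g h :
  row_rrho_col (gV k g) * row_rrho_col (gV k h) =
  row_rrho_col (gV k (g * x1 * h)%g) - row_rrho_col (gV k (g * h)%g).
Proof.
rewrite !row_rrho_colU !rrho_eltM rrho_elt_x1; exact: mulmx_rank1.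
Qed.

Definition X0exp (n : int) : VB2 k := gVV k (gexpz x0 n, 1%g).
Definition Y0exp (n : int) : VB2 k := gVV k (1%g, gexpz x0 n).

(** The element t_n, for every integer n. *)
Definition exp_coef (n : int) : VB2 k :=
  Y0exp n - csum 1 (n - 1) (fun j => X0exp j * (TX k true - 1) * Y0exp (n - j)).

Lemma X0expS n : X0exp (n + 1) = TX k false * X0exp n.
Proof. by rewrite /X0exp gexpzS [RHS]gVVM mulg1. Qed.

Lemma Y0expS n : Y0exp (n + 1) = TY k false * Y0exp n.
Proof. by rewrite /Y0exp gexpzS [RHS]gVVM mulg1. Qed.

(** By convention the sum from 1 to -1 is minus its term at j = 0, so t_0 = 1 + (X_1 - 1). *)
Lemma exp_coef0 : exp_coef 0 = TX k true.
Proof.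
rewrite /exp_coef /csum /= big_ord1 /= mulr1 mul1r opprK addrC; exact: subrK.
Qed.

(** After the term j = 1 is split off, shifting the index of the remaining sum lets X_0 factor out
    on the left. *)
Lemma exp_coefS n : exp_coef (n + 1) =
  TX k false * exp_coef n + TY k false * Y0exp n - TX k false * TX k true * Y0exp n.
Proof.
(* Here a = X_0, b = X_1, p = Y_0^(n+1), q = Y_0^n, and c is the sum in t_n. *)
have expand (T : nzRingType) (a b c p q : T) :
    p - (a * (b - 1) * q + a * c) = a * (q - c) + p - a * b * q.
  by rewrite !(mulrBr, mulrBl, mulr1, mulrA); zmod.
have assoc4 (T : nzRingType) (a b c d : T) : a * b * c * d = a * (b * c * d).
  by rewrite !mulrA.
have qX1 : X0exp 1 = TX k false by rewrite (X0expS 0); exact: mulr1.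
rewrite /exp_coef csum_recl addrK [in csum _ n _](_ : n = n - 1 + 1);
  last by rewrite subrK.
rewrite csum_shift Y0expS qX1 addrK.
apply: (etrans _ (expand _ _ _ _ _ _)); congr (_ - (_ + _)).
apply: etrans (esym (mulr_csumr _ _ _ _)); apply: eq_csum => j.
rewrite X0expS (_ : n + 1 - (j + 1) = n - j); last by lia.
exact: assoc4.
Qed.

(* The product of [rrho_elt (gexpz x0 n)] with [rcol]: the bottom block of
   [rrho_elt x0] preserves the shape of the last two entries because
   [Y_1^-1 Y_0 Y_1] commutes with [X_0] and [X_1]. *)
Definition exp_vec (n : int) : 'cV[VB2 k]_3 :=
  cv3 [:: TYinv k true * X0exp n * (TX k true - 1);
          TXinv k true * TYinv k true * exp_coef n * (1 - TY k true);
          TYinv k true * TYinv k false * TY k true * TX k false * TX k true *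
            TYinv k true * (TXinv k true * exp_coef n - Y0exp n) * (1 - TY k true)].

Lemma rrho_elt_x0_exp_vec n : rrho_elt x0 *m exp_vec n = exp_vec (n + 1).
Proof.
have rho_x0V : rho_elt k x0^-1%g = rhoX0inv k by rewrite /rho_elt /= mulmx1.
rewrite /exp_vec exp_coefS X0expS Y0expS /rrho_elt rho_x0V.
exact: (block_R0 gVVM (op := gopvv) (@gop1 _ _) (@gopM _ _) gop_gVV
  x0 x1 x0 x1 (Y0exp n) (X0exp n) (exp_coef n)).
Qed.

Lemma rrho_elt_exp_col n : rrho_elt (gexpz x0 n) *m rcol k = exp_vec n.
Proof.
have -> : rcol k = exp_vec 0.
  by rewrite /exp_vec exp_coef0; exact: (block_col gVV1 gVVM x0 x1 x0 x1).
exact: (rep_gexpz rrho_elt1 rrho_eltM rrho_elt_x0_exp_vec).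
Qed.

Lemma row_rrho_col_exp n :
  row_rrho_col (gV k (gexpz x0 n)) =
  X0exp n * (TX k true - 1) + exp_coef n * (TY k true - 1).
Proof.
rewrite row_rrho_colU -mulmxA rrho_elt_exp_col.
exact: (block_row gVV1 gVVM x0 x1 x0 x1).
Qed.

End RhoMorphism.

(** * An induction principle for the free group *)

Definition letter_elt (l : letter) : F2 :=
  if l.2 then (f2gen l.1)^-1%g else f2gen l.1.

Lemma F2_cons l w (Hlw : reduced (l :: w)) :
  MkF2 Hlw = (letter_elt l * MkF2 (reduced_cons Hlw))%g.
Proof.
have lw : lcons l w = l :: w.
  by case: w Hlw => [|l' w] //= /andP [/negbTE ->].
apply: val_inj; apply: etrans (esym lw) _.
by move: (reduced_cons Hlw); case: l {Hlw lw} => [[] []].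
Qed.

(* Mirrors the generation of [W^B] by [X_1^-1] and the [X_0^n (X_1 - 1)]:
   [(g (X_1 - 1)) (h (X_1 - 1)) = (g X_1 h) (X_1 - 1) - (g h) (X_1 - 1)].
   The induction on words proves [P (X_0^n h)] for all [n] at once. *)
Lemma F2_generation (P : F2 -> Prop)
    (x0 := f2gen false) (x1 := f2gen true) :
  (forall n, P (gexpz x0 n)) -> P x1^-1%g ->
  (forall g h, P g -> P h -> (P (g * x1 * h)%g <-> P (g * h)%g)) ->
  forall g, P g.
Proof.
move=> P_exp P_x1V P_split g.
suff Pexp h n : P (gexpz x0 n * h)%g by have := Pexp g 0; rewrite mul1g.
case: h => w Hw; elim: w Hw n => [|l w IH] Hw n.
  by rewrite (_ : MkF2 Hw = 1%g) ?mulg1 //; exact: val_inj.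
rewrite F2_cons; move: (reduced_cons Hw) => Hw'; pose h := MkF2 Hw'.
have {}IH m : P (gexpz x0 m * h)%g by exact: IH.
have Ph : P h by have := IH 0; rewrite mul1g.
case: l {Hw} => [[] []]; rewrite /letter_elt [_.1]/= [_.2]/= -/h.
(* [P_split] is used twice from left to right: at x1^-1 x1 h = h, then at x0^n x1 (x1^-1 h) = x0^n
   h. *)
- have Px1Vh : P (x1^-1 * h)%g.
    by apply/(P_split _ _ P_x1V Ph); rewrite mulVg mul1g.
  by apply/(P_split _ _ (P_exp n) Px1Vh); rewrite -mulgA mulVKg; exact: IH.
- by rewrite mulgA; apply/(P_split _ _ (P_exp n) Ph); exact: IH.
- rewrite mulgA (_ : (gexpz x0 n * _)%g = gexpz x0 (n - 1)) //.
  by rewrite -{1}(subrK 1 n) gexpzSr mulgK.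
- by rewrite mulgA -gexpzSr.
Qed.

Lemma gVM (k : comAlgType rat) g h : gV k g * gV k h = gV k (g * h)%g.
Proof. exact: galgU1_mul. Qed.

(** Converts equal differences into the equivalence that [F2_generation] asks for. *)
Lemma subr_eq_iff (V : zmodType) (a b c d : V) :
  a - b = c - d -> (a = c <-> b = d).
Proof.
by move=> abcd; split=> E; move: abcd; rewrite E; [move/addrI/oppr_inj|move/addIr].
Qed.

Lemma mulr_subr1 (T : nzRingType) (a b : T) : a * (b - 1) = a * b - a.
Proof. by rewrite mulrBr mulr1. Qed.

(** * Comparison on the generators *)

Section Main.
Variable k : comAlgType rat.
Local Notation x0 := (f2gen false).
Local Notation x1 := (f2gen true).

(** With q = [row_rrho_col], the relation for g = 1 and h = X_1^-1 reads q(1) q(h) = q(1) - q(h). As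
    q(1) = X_1 Y_1 - 1, this gives X_1 Y_1 q(h) = X_1 Y_1 - 1, and X_1 Y_1 is invertible. *)
Lemma row_rrho_col_x1V :
  row_rrho_col (gV k x1^-1%g) = 1 - TXinv k true * TYinv k true.
Proof.
have q1 : row_rrho_col (gV k 1%g) = TX k true * TY k true - 1.
  apply: etrans (row_rrho_col_exp k 0) _; rewrite exp_coef0.
  rewrite (_ : X0exp k 0 = 1) //.
  have expand (T : nzRingType) (a b : T) : 1 * (a - 1) + a * (b - 1) = a * b - 1.
    by rewrite mul1r mulrBr mulr1 addrC addrA subrK.
  exact: expand.
have := row_rrho_colM k 1%g x1^-1%g; rewrite !mul1g mulgV q1.
have : TXinv k true * TYinv k true * (TX k true * TY k true) = 1.
  apply: etrans (congr2 *%R (gVVM _ _ _ _ _) (gVVM _ _ _ _ _)) _.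
  apply: etrans (gVVM _ _ _ _ _) _.
  by rewrite !(mul1g, mulg1) mulVg.
have solve (T : nzRingType) (a b q : T) :
   b * a = 1 -> (a - 1) * q = (a - 1) - q -> q = 1 - b.
  move=> ba1 /(congr1 ( *%R b)).
  rewrite mulrBl mul1r !mulrBr mulrA ba1 mul1r mulr1.
  by move/(canRL (subrK _)) => ->; rewrite subrK.
exact: solve.
Qed.

Lemma tens1E v : tens1 v = linext (fun g => gVV k (g, 1%g)) v.
Proof. by apply: eq_bigr => g _; rewrite /gVV scale_galgU mulr1. Qed.

Lemma tens2E v : tens2 v = linext (fun g => gVV k (1%g, g)) v.
Proof. by apply: eq_bigr => g _; rewrite /gVV scale_galgU mulr1. Qed.

Lemma tens1U g : tens1 (gV k g) = gVV k (g, 1%g).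
Proof. by rewrite tens1E linextU scale1r. Qed.

Lemma tens2U g : tens2 (gV k g) = gVV k (1%g, g).
Proof. by rewrite tens2E linextU scale1r. Qed.

Lemma WgenE n : Wgen k n = gV k (gexpz x0 n * x1)%g - gV k (gexpz x0 n).
Proof.
rewrite /Wgen mulr_subr1; congr (_ - _); exact: galgU1_mul.
Qed.

Lemma tens1_Wgen n : tens1 (Wgen k n) = X0exp k n * (TX k true - 1).
Proof.
rewrite WgenE tens1E linextB -!tens1E !tens1U; apply: esym.
apply: etrans (mulr_subr1 _ _) _; congr (_ - _).
by apply: etrans (gVVM _ _ _ _ _) _; rewrite mulg1.
Qed.

Lemma tens2_Wgen n : tens2 (Wgen k n) = Y0exp k n * (TY k true - 1).
Proof.
rewrite WgenE tens2E linextB -!tens2E !tens2U; apply: esym.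
apply: etrans (mulr_subr1 _ _) _; congr (_ - _).
by apply: etrans (gVVM _ _ _ _ _) _; rewrite mulg1.
Qed.

Lemma tens1_1 : tens1 (1 : VB k) = 1.
Proof. exact: (tens1U 1%g). Qed.

Lemma tens2_1 : tens2 (1 : VB k) = 1.
Proof. exact: (tens2U 1%g). Qed.

Lemma tens_1r a : tens a 1 = tens1 a :> VB2 k.
Proof. rewrite /tens tens2_1; exact: mulr1. Qed.

Lemma tens_1l a : tens 1 a = tens2 a :> VB2 k.
Proof. rewrite /tens tens1_1; exact: mul1r. Qed.

(** The second term and the sum share the right factor Y_1 - 1; together they form t_n (Y_1 - 1). *)
Lemma row_rrho_col_Wgen n :
  tens (Wgen k n) 1 + tens 1 (Wgen k n)
    - csum 1 (n - 1) (fun j => tens (Wgen k j) (Wgen k (n - j))) =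
  row_rrho_col (gV k (gexpz x0 n)).
Proof.
apply: etrans (esym (addrA _ _ _)) (etrans _ (esym (row_rrho_col_exp k n))).
apply: (congr2 +%R); first exact: etrans (tens_1r _) (tens1_Wgen _).
apply: etrans _ (esym (mulrBl _ _ _)); apply: (congr2 (fun a b => a - b)).
  exact: etrans (tens_1l _) (tens2_Wgen _).
apply: etrans _ (esym (mulr_csuml _ _ _ _)); apply: eq_csum => j.
by apply: etrans (congr2 *%R (tens1_Wgen _) (tens2_Wgen _)) _; exact: mulrA.
Qed.

End Main.

Theorem theorem3p5 (k : comAlgType rat) (Delta : VB k -> VB2 k)
  (* Delta^{W,B} is a k-algebra morphism W^B -> W^B (x) W^B (followed by the
     inclusion into V^B (x) V^B) *)
  (Delta_add : forall a b, inW a -> inW b -> Delta (a + b) = Delta a + Delta b)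
  (Delta_scale : forall (c : k) a, inW a -> Delta (c *: a) = c *: Delta a)
  (Delta_mul : forall a b, inW a -> inW b -> Delta (a * b) = Delta a * Delta b)
  (Delta_one : Delta 1 = 1)
  (* Delta(X_1^{-1}) = X_1^{-1} (x) X_1^{-1} *)
  (Delta_X1inv : Delta (VXinv k true) = tens (VXinv k true) (VXinv k true))
  (* Delta(X_0^n (X_1 - 1)) = X_0^n(X_1-1) (x) 1 + 1 (x) X_0^n(X_1-1)
                              - sum_{j=1}^{n-1} X_0^j(X_1-1) (x) X_0^{n-j}(X_1-1) *)
  (Delta_gen : forall n : int,
     Delta (Wgen k n) =
       tens (Wgen k n) 1 + tens 1 (Wgen k n)
       - csum 1 (n - 1) (fun j => tens (Wgen k j) (Wgen k (n - j)))) :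
  forall (c : k) (v : VB k),
    Delta (c *: (1 : VB k) + v * (VX k true - 1)) = DeltaOmat c v.
Proof.
set e := VX k true - 1.
have W_e v : inW (v * e) by exists 0, v; rewrite scale0r add0r.
have W_1 (c : k) : inW (c *: (1 : VB k)) by exists c, 0; rewrite mul0r addr0.
have Delta_e_linear : linear (fun v => Delta (v * e)).
  move=> c u v; rewrite mulrDl -scalerAl Delta_add ?Delta_scale //.
  by exists 0, (c *: u); rewrite scale0r add0r scalerAl.
have W1 : inW (1 : VB k) by have := W_1 1; rewrite scale1r.
suff Delta_e g : Delta (gV k g * e) = row_rrho_col (gV k g).
  move=> c v; rewrite Delta_add // Delta_scale // Delta_one; congr (_ + _).
  exact: (galg_linear_ext Delta_e_linear (@row_rrho_col_linear k) Delta_e v).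
have Delta_eB u v : Delta ((u - v) * e) = Delta (u * e) - Delta (v * e).
  exact: (GRing.zmod_morphism_linear Delta_e_linear).
elim/F2_generation: g => [n||g h Pg Ph].
- by rewrite -row_rrho_col_Wgen -Delta_gen.
(* Delta is prescribed at X_1^-1 itself; z (X_1 - 1) = 1 - z turns this into its value on z (X_1 -
   1). *)
- set z := gV k _; have ze : z * e = 1 - z.
    rewrite /e mulr_subr1; apply: (congr2 (fun a b => a - b)) => //.
    by apply: etrans (gVM _ _ _) _; rewrite mulVg.
  have W_z : inW z.
    by exists 1, (- z); rewrite -/e scale1r mulNr ze opprB addrC subrK.
  have ze_z : z * e + z = 1 by rewrite ze subrK.
  have Delta_ze : Delta (z * e) = 1 - Delta z.
    apply: (canRL (addrK _)); apply: etrans (esym (Delta_add _ _ (W_e z) W_z)) _.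
    exact: etrans (congr1 Delta ze_z) Delta_one.
  apply: etrans Delta_ze (etrans _ (esym (row_rrho_col_x1V k))).
  apply: (congr1 (fun a => 1 - a)).
  exact: etrans Delta_X1inv (congr2 *%R (tens1U _ _) (tens2U _ _)).
(* Multiplied on the right by [e], the right-hand side is a product of two elements of W^B, to which
   [Delta_mul] applies. *)
have split_ge : gV k (g * f2gen true * h)%g - gV k (g * h)%g =
    gV k g * e * gV k h.
  rewrite /e mulr_subr1 mulrBl; congr (_ - _); apply: esym.
    by apply: etrans (congr1 ( *%R^~ _) (gVM _ _ _)) _; exact: gVM.
  exact: gVM.
apply: subr_eq_iff; apply: etrans (esym (Delta_eB _ _)) _.
apply: etrans (congr1 (fun u => Delta (u * e)) split_ge) _.
apply: etrans (congr1 Delta (esym (mulrA _ _ _))) _.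
apply: etrans (Delta_mul _ _ (W_e _) (W_e _)) _.
exact: etrans (congr2 *%R Pg Ph) (row_rrho_colM _ _ _).
Qed.
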